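(* Let $p$ be a prime, let $0<\delta\leq 1/(20p)$, and let $\epsilon:\mathbb{N}\to(0,1)$ be a non-increasing function such that $\epsilon(d)\leq \sqrt{\delta}/(80p^2(d+1))$ for all $d\in\mathbb{N}$. Then for every sufficiently large $n$ there exists a function $f:\mathbb{F}_p^n\to[0,1]$ with the following property. If $W_2\leqslant W_1\leqslant \mathbb{F}_p^n$ are subspaces of codimensions $C_2$ and $C_1$ respectively such that (i) $\mathcal{P}(W_2)$ is $\epsilon(C_1)$-regular for $f$, and (ii) $\mathcal{E}(W_2)-\mathcal{E}(W_1)\leq\delta$, then $C_2, C_1 > \mathrm{wwz}(\lfloor \delta^{-1/2}/(10p)\rfloor)$. In particular, if $C^{(1)}$ is a constant such that for every $n$ and every $f:\mathbb{F}_p^n\to[0,1]$ there exist subspaces $W_2\leqslant W_1\leqslant\mathbb{F}_p^n$ with $\mathrm{codim}\, W_1\leq C^{(1)}$ satisfying (i) and (ii), then $C^{(1)}>\mathrm{wwz}(\lfloor \delta^{-1/2}/(10p)\rfloor)$.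
   Context: $\mathbb{N}=\{0,1,2,\dots\}$. Write $e_p(t)=\exp(2\pi i t/p)$ and $r^Tx=\sum_k r_kx_k$ for $r,x\in\mathbb{F}_p^n$. For a subspace $H\leqslant\mathbb{F}_p^n$, $\mathcal{P}(H)$ denotes the partition of $\mathbb{F}_p^n$ into cosets of $H$. For $F:\mathbb{F}_p^n\to\mathbb{C}$ and $c,r\in\mathbb{F}_p^n$, the Fourier transform of $F$ on $H+c$ at $r$ is $\widehat{F|_{H+c}}(r)=\mathbb{E}_{x\in H+c}F(x)e_p(r^Tx)$. A function $f$ is $\epsilon$-uniform on $H+c$ if $|\widehat{F|_{H+c}}(r)|\leq\epsilon$ for all $r$, where $F=f-\mathbb{E}_{x\in H+c}f(x)$. The partition $\mathcal{P}(H)$ is $\epsilon$-regular for $f$ if for all but an $\epsilon$-proportion of $c\in\mathbb{F}_p^n$, $f$ is $\epsilon$-uniform on $H+c$. For a partition $\mathcal{P}$, $\mathbb{E}(f|\mathcal{P})(x)$ is the average of $f$ over the part containing $x$; the energy is $\mathcal{E}(\mathcal{P})=\mathbb{E}_{x\in\mathbb{F}_p^n}\mathbb{E}(f|\mathcal{P})(x)^2$, and $\mathcal{E}(H)=\mathcal{E}(\mathcal{P}(H))$ (energies taken with respect to $f$). The tower function is $\mathrm{twr}(0)=1$, $\mathrm{twr}(i+1)=2^{\mathrm{twr}(i)}$; the wowzer function is $\mathrm{wwz}(1)=2$, $\mathrm{wwz}(i+1)=\mathrm{twr}(\mathrm{wwz}(i))$. *)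

(* Defs.v *)
From mathcomp Require Import all_boot all_order all_algebra.
From mathcomp Require Import all_reals all_analysis.
From mathcomp Require Import complex.

Set Implicit Arguments.
Unset Strict Implicit.
Unset Printing Implicit Defensive.

Import Order.TTheory GRing.Theory Num.Theory.

Local Open Scope ring_scope.

Fixpoint twr (i : nat) : nat := if i is j.+1 then (2 ^ twr j)%N else 1%N.

(* The sequence is usually started at wwz 1 = 2. The value wwz 0 = 1 is the
   one forced by the recursion wwz 1 = twr (wwz 0). *)
Fixpoint wwz (i : nat) : nat := if i is j.+1 then twr (wwz j) else 1%N.

Definition avg (T : finType) (K : fieldType) (A : {set T}) (F : T -> K) : K :=
  (\sum_(x in A) F x) / #|A|%:R.

Definition dotp (p n : nat) (r x : 'rV['F_p]_n) : 'F_p :=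
  \sum_(k < n) r ord0 k * x ord0 k.

(* exp (2 pi i t / p), for p prime; t is read as its representative in
   {0, ..., p - 1}. *)
Definition e_ (R : realType) (p : nat) (t : 'F_p) : R[i] :=
  let theta : R := 2 * pi * (nat_of_ord t)%:R / p%:R in
  Complex (cos theta) (sin theta).

Section Regularity.
Variables (R : realType) (p n : nat).
Local Notation V := 'rV['F_p]_n.

Definition coset (H : {vspace V}) (c : V) : {set V} := [set x | x - c \in H].

Definition cosets (H : {vspace V}) : {set {set V}} := [set coset H c | c : V].

Definition codim (H : {vspace V}) : nat := (n - \dim H)%N.

Definition fourier (F : V -> R[i]) (H : {vspace V}) (c r : V) : R[i] :=
  avg (coset H c) (fun x => F x * e_ R (dotp r x)).

(* `|z| is the modulus of z, as an element of R[i]. *)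
Definition uniform_on (eps : R) (f : V -> R) (H : {vspace V}) (c : V) : bool :=
  let F x := (f x - avg (coset H c) f)%:C%C in
  [forall r : V, `|fourier F H c r| <= eps%:C%C].

Definition regular (eps : R) (f : V -> R) (H : {vspace V}) : bool :=
  #|[set c : V | ~~ uniform_on eps f H c]|%:R <= eps * #|{: V}|%:R.

Definition condexp (f : V -> R) (P : {set {set V}}) (x : V) : R :=
  avg (pblock P x) f.

Definition energy (f : V -> R) (P : {set {set V}}) : R :=
  avg [set: V] (fun x => condexp f P x ^+ 2).

Definition energy_vs (f : V -> R) (H : {vspace V}) : R := energy f (cosets H).

End Regularity.

(* Main.v *)
(* For a flag of subspaces H_0 > H_1 > ... take f = 1/2 + sum_j a_j g_j with
   g_j(x) = cos (2 pi <xi_j(x), x> / p), where xi_j is constant on cosets of H_j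
   and orthogonal to H_(j+1), and such that every v in H_j outside H_(j+1) has
   <xi_j(x), v> <> 0 for at least 3/8 of all x.  Given such a v, let h be g_j
   restricted to the x with <xi_j(x), v> <> 0.  Averaging along v kills the
   correlation of h with the levels below j, averaging over H_k kills the one
   with a level k > j, so <f, h> = a_j |h|^2.  This single identity is used twice.
   If W2 <= H_j contains v, then <f, h> is also an average of Fourier
   coefficients of f at xi_j(c) on the cosets W2 + c, so eps-regularity forces
   a_j <= 22/3 eps: a regular W2 lies in every H_j whose previous levels have
   amplitude at least 15/2 eps.  If W2 <= H_(j+1) while v lies in W1, then h is
   W2-measurable and orthogonal to the W1-measurable functions, so the energy gap
   is at least 3/16 a_j^2.

   The xi_j come from a Reed-Solomon code concatenated with the Hadamard code, so
   codim H_(j+1) is exponential in codim H_j.  Stage k starts at codimension e_k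
   and has e_k + 13 levels of amplitude about sqrt delta / (e_k + 1), which reach
   e_(k+1) >= twr e_k, followed by one level of amplitude 5/2 sqrt delta; it costs
   O(sqrt delta) in amplitude, so s + 1 stages fit.  If e_k <= codim W1 <= e_(k+1)
   then W2 is pushed below the last level of stage k, which W1 cannot see. *)

Require Import Defs.
From mathcomp Require Import all_boot all_order all_algebra.
From mathcomp Require Import all_reals all_analysis.
From mathcomp Require Import complex.
From mathcomp Require Import finfield ring lra zify.

Set Implicit Arguments.
Unset Strict Implicit.
Unset Printing Implicit Defensive.

Import Order.TTheory GRing.Theory Num.Theory.

Local Open Scope ring_scope.

(** * Sums of cosines over the residues mod p *)

Definition psi (R : realType) (p : nat) (t : 'F_p) : R :=
  cos (2 * pi * (nat_of_ord t)%:R / p%:R).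

Section Trig.
Variables (R : realType) (p : nat).
Hypothesis p_pr : prime p.

Lemma sum_Fp (G : nat -> R) : \sum_(t : 'F_p) G t = \sum_(0 <= i < p) G i.
Proof. by rewrite -(big_mkord xpredT G) Fp_cast. Qed.

(* Telescoping: 2 sin x cos (2 i x) = sin ((2 i + 1) x) - sin ((2 i - 1) x). *)
Lemma sum_cos_arith (x : R) (n : nat) :
  2 * sin x * \sum_(0 <= i < n) cos (2 * x * i%:R) =
  sin (2 * x * n%:R - x) + sin x.
Proof.
elim: n => [|n IHn]; first by rewrite big_geq// mulr0 mulr0 sub0r sinN addNr.
rewrite big_nat_recr//= mulrDr IHn.
have -> : 2 * x * n.+1%:R - x = 2 * x * n%:R + x.
  by rewrite -[n.+1]addn1 natrD mulr1n; ring.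
by rewrite sinB sinD; ring.
Qed.

Lemma sin_2piMn (x : R) (n : nat) : sin (x + 2 * pi * n%:R) = sin x.
Proof.
elim: n => [|n IHn]; first by rewrite mulr0 addr0.
have -> : x + 2 * pi * n.+1%:R = (x + 2 * pi * n%:R) + pi *+ 2.
  by rewrite -[n.+1]addn1 natrD mulr1n -mulr_natl; ring.
by rewrite sinD2pi.
Qed.

(** At x = pi k / p the two end terms of the telescoped sum cancel by periodicity, and the
    hypothesis allows division by sin x. *)
Lemma sum_cos_root (k : nat) : sin (pi * k%:R / p%:R :> R) != 0 ->
  \sum_(0 <= i < p) cos (2 * (pi * k%:R / p%:R) * i%:R : R) = 0.
Proof.
move=> sin_neq0; set x := pi * _ / _ in sin_neq0 *.
have p_neq0 : p%:R != 0 :> R by rewrite pnatr_eq0 -lt0n prime_gt0.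
apply: (mulfI (x := 2 * sin x)); first by rewrite mulf_neq0// pnatr_eq0.
rewrite sum_cos_arith mulr0.
have -> : 2 * x * p%:R - x = - x + 2 * pi * k%:R.
  by rewrite {1}/x; field.
by rewrite sin_2piMn sinN addNr.
Qed.

Lemma sum_psi : \sum_(t : 'F_p) psi R t = 0.
Proof.
rewrite (sum_Fp (fun i => cos (2 * pi * i%:R / p%:R))).
rewrite -[RHS](@sum_cos_root 1); last first.
  rewrite mulr1n mulr1 gt_eqF// sin_gt0_pi// divr_gt0 ?pi_gt0 ?ltr0n ?prime_gt0//=.
  rewrite ltr_pdivrMr ?ltr0n ?prime_gt0// ltr_pMr ?pi_gt0// ltr1n.
  exact: prime_gt1.
by apply: eq_bigr => i _; congr cos; rewrite mulr1n; ring.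
Qed.

(** Pass to the doubled angle. The sum of the doubled cosines vanishes for odd p but equals 2 for p
    = 2, hence an inequality. *)
Lemma sum_psi_sq : p%:R / 2 <= \sum_(t : 'F_p) psi R t ^+ 2.
Proof.
have p0 : 0 < p%:R :> R by rewrite ltr0n prime_gt0.
have -> : \sum_(t : 'F_p) psi R t ^+ 2 =
    p%:R / 2 + (\sum_(0 <= i < p) cos (2 * (pi * 2%:R / p%:R) * i%:R)) / 2.
  rewrite (sum_Fp (fun i => cos (2 * pi * i%:R / p%:R) ^+ 2)).
  have -> : p%:R / 2 = \sum_(0 <= i < p) 2^-1 :> R.
    by rewrite sumr_const_nat subn0 -[RHS]mulr_natl.
  rewrite mulr_suml -big_split/=; apply: eq_bigr => i _.
  have -> : 2 * (pi * 2%:R / p%:R) * i%:R = (2 * pi * i%:R / p%:R : R) *+ 2.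
    by rewrite -mulr_natr; ring.
  by rewrite cos_mulr2n; field.
rewrite lerDl divr_ge0//; have [p2|p_neq2] := eqVneq p 2.
  rewrite {1}p2 big_mkord !big_ord_recl big_ord0 /= mulr0 cos0 p2.
  have -> : 2 * (pi * 2%:R / 2%:R) * 1%:R = pi *+ 2 :> R.
    by rewrite -mulr_natr; field.
  by rewrite cos2pi; lra.
rewrite sum_cos_root// gt_eqF// sin_gt0_pi//; apply/andP; split.
  by rewrite divr_gt0// mulr_gt0 ?pi_gt0.
rewrite ltr_pdivrMr// ltr_pM2l ?pi_gt0// ltr_nat.
by rewrite ltn_neqAle eq_sym p_neq2 prime_gt1.
Qed.

Lemma psi_abs_le1 (t : 'F_p) : `|psi R t| <= 1.
Proof. by rewrite ler_norml cos_geN1 cos_le1. Qed.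

Lemma sum_affine (G : 'F_p -> R) (a b : 'F_p) : b != 0 ->
  \sum_(t : 'F_p) G (a + t * b) = \sum_(t : 'F_p) G t.
Proof.
move=> b_neq0; rewrite [RHS](reindex_inj (addrI a)).
by rewrite [RHS](reindex_inj (mulIf b_neq0)).
Qed.

End Trig.

(** * Averages over cosets, Fourier coefficients and energy *)

Section Averages.
Variables (R : realType) (p n : nat).
Hypothesis p_pr : prime p.
Local Notation V := 'rV['F_p]_n.
Implicit Types (W : {vspace V}) (r x y c h v : V) (F G : V -> R).

Lemma dotpDr r x y : dotp r (x + y) = dotp r x + dotp r y.
Proof. by rewrite -big_split; apply: eq_bigr => k _; rewrite mxE mulrDr. Qed.

Lemma dotpZr r t x : dotp r (t *: x) = t * dotp r x.
Proof. by rewrite mulr_sumr; apply: eq_bigr => k _; rewrite mxE mulrCA. Qed.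

Lemma dotp0 r : dotp r 0 = 0.
Proof. by rewrite -(scale0r 0) dotpZr mul0r. Qed.

Lemma sum_shift F h : \sum_x F (x + h) = \sum_x F x.
Proof. by rewrite [RHS](reindex_inj (addIr h)). Qed.

Lemma sum_line F v :
  p%:R * \sum_x F x = \sum_x \sum_(t : 'F_p) F (x + t *: v).
Proof.
rewrite exchange_big/= -{1}(card_Fp p_pr) mulr_natl -sumr_const.
by apply: eq_bigr => t _; rewrite sum_shift.
Qed.

(** [P] is a union of lines in direction [h0], and on each of them the argument of [psi] runs
    through all residues. A bare predicate covers both the subspaces [W] and the flag. *)
Lemma sum_psi_subspace (P : pred V) r (a : 'F_p) h0 :
  (forall h t, P h -> P (h + t *: h0)) -> dotp r h0 != 0 ->
  \sum_(h | P h) psi R (a + dotp r h) = 0.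
Proof.
move=> Pline r_h0; have p0 : p%:R != 0 :> R by rewrite pnatr_eq0 -lt0n prime_gt0.
have P_iff h t : P (h + t *: h0) = P h.
  apply/idP/idP => [|/Pline//] /(Pline _ (- t)).
  by rewrite scaleNr addrK.
apply: (mulfI p0); rewrite mulr0 big_mkcond (sum_line _ h0) big1// => h _.
under eq_bigr do rewrite P_iff.
case: (P h); last by rewrite big1.
under eq_bigr do rewrite dotpDr dotpZr addrA.
by rewrite (sum_affine (@psi R p))// sum_psi.
Qed.

Lemma coset_shift (K : fieldType) (F : V -> K) W c :
  \sum_(x in coset W c) F x = \sum_(h in W) F (c + h).
Proof.
rewrite (reindex_inj (addrI c)); apply: eq_bigl => h.
by rewrite inE addrAC subrr add0r.
Qed.

Lemma card_coset W c : #|coset W c| = #|W|.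
Proof.
rewrite -(card_imset W (addrI c)); apply: eq_card => x.
rewrite inE; apply/idP/imsetP => [xc|[h hW ->]].
  by exists (x - c); rewrite // addrC subrK.
by rewrite addrAC subrr add0r.
Qed.

Lemma avg_coset (K : fieldType) (F : V -> K) W c :
  avg (coset W c) F = (\sum_(h in W) F (c + h)) / #|W|%:R.
Proof. by rewrite /avg coset_shift card_coset. Qed.

Lemma card_vspace_gt0 W : 0 < #|W|%:R :> R.
Proof. by rewrite ltr0n; apply/card_gt0P; exists 0; exact: mem0v. Qed.

Lemma avg_cosetN1 F W c : (forall x, `|F x| <= 1) -> `|avg (coset W c) F| <= 1.
Proof.
move=> F1; rewrite avg_coset normrM normfV normr_nat.
rewrite ler_pdivrMr ?card_vspace_gt0// mul1r.
rewrite (le_trans (ler_norm_sum _ _ _))//.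
by rewrite (le_trans (ler_sum _ (fun h _ => F1 _)))// sumr_const.
Qed.

Lemma avg_coset_itv F W c :
  (forall x, 0 <= F x <= 1) -> 0 <= avg (coset W c) F <= 1.
Proof.
move=> F01; apply/andP; split.
  rewrite avg_coset divr_ge0//; apply: sumr_ge0 => h _.
  by case/andP: (F01 (c + h)).
rewrite (le_trans (ler_norm _))// avg_cosetN1// => x.
by case/andP: (F01 x) => ? ?; rewrite ger0_norm.
Qed.

Lemma Re_fourier F W c r :
  complex.Re (fourier (fun x => (F x)%:C%C) W c r) =
  avg (coset W c) (fun x => F x * psi R (dotp r x)).
Proof.
have Re_sum (I : finType) (P : pred I) (Z : I -> R[i]) :
    complex.Re (\sum_(i | P i) Z i) = \sum_(i | P i) complex.Re (Z i).
  by apply: (big_morph (@complex.Re R)) => // -[? ?] [].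
have Re_mulC (z : R[i]) (b : R) : complex.Re (z * b%:C%C) = complex.Re z * b.
  by case: z => u w /=; rewrite mulr0 subr0.
rewrite /fourier /avg -(rmorph_nat (real_complex R)) -fmorphV Re_mulC Re_sum.
congr (_ / _); apply: eq_bigr => x _.
by rewrite [_ * e_ _ _]mulrC Re_mulC mulrC.
Qed.

Lemma Re_uniform (eps : R) F W c r : uniform_on eps F W c ->
  avg (coset W c) (fun x => (F x - avg (coset W c) F) * psi R (dotp r x)) <= eps.
Proof.
move=> /forallP/(_ r) le_eps; rewrite -Re_fourier.
have /(le_trans (normc_ge_Re _)) := le_eps.
by rewrite lecR; exact/le_trans/ler_norm.
Qed.

Lemma coset_addr W c h : h \in W -> coset W (c + h) = coset W c.
Proof.
move=> hW; apply/setP => x; rewrite !inE opprD addrA.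
by rewrite rpredBr.
Qed.

Lemma pblock_cosets W x : pblock (cosets W) x = coset W x.
Proof.
have xx y : y \in coset W y by rewrite inE subrr mem0v.
apply: def_pblock; last by [].
  apply/trivIsetP => _ _ /imsetP[c _ ->] /imsetP[d _ ->].
  apply: contraR => /pred0Pn[y /andP[/=]]; rewrite !inE => yc yd.
  by rewrite -(coset_addr c yc) -(coset_addr d yd) ![_ + (y - _)]addrC !subrK.
by apply/imsetP; exists x.
Qed.

Definition proj W F x := avg (coset W x) F.

Lemma energyE F W : energy_vs F W = (\sum_x proj W F x ^+ 2) / #|{: V}|%:R.
Proof.
rewrite /energy_vs /energy /avg cardsT; congr (_ / _).
by apply: eq_big => [x|x _]; rewrite ?inE// /condexp pblock_cosets.
Qed.

Lemma proj_inv W F x h : h \in W -> proj W F (x + h) = proj W F x.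
Proof. by move=> hW; rewrite /proj coset_addr. Qed.

(** [proj W F] is an average of shifts of [F] by elements of [W], and each shift leaves the pairing
    with a [W]-invariant [G] unchanged. *)
Lemma sum_proj W F G : (forall x h, h \in W -> G (x + h) = G x) ->
  \sum_x proj W F x * G x = \sum_x F x * G x.
Proof.
move=> Ginv; apply: (mulfI (lt0r_neq0 (card_vspace_gt0 W))).
rewrite [RHS]mulr_natl -[RHS]sumr_const mulr_sumr.
have projE x : #|W|%:R * (proj W F x * G x) =
    \sum_(h in W) F (x + h) * G (x + h).
  rewrite /proj avg_coset mulrA [_ * (_ / _)]mulrC.
  rewrite divfK ?gt_eqF ?card_vspace_gt0// mulr_suml.
  by apply: eq_bigr => h hW; rewrite (Ginv x h hW).
under eq_bigr do rewrite projE.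
rewrite exchange_big; apply: eq_bigr => h _.
by rewrite (sum_shift (fun x => F x * G x)).
Qed.

(** Bessel's inequality: by Pythagoras the gap is the mean square of [proj W2 F - proj W1 F], whose
    component along [G] is [a * G]. *)
Lemma energy_gap W1 W2 F G (a : R) : (W2 <= W1)%VS ->
  (forall x h, h \in W2 -> G (x + h) = G x) ->
  \sum_x proj W1 F x * G x = 0 ->
  \sum_x F x * G x = a * \sum_x G x ^+ 2 ->
  a ^+ 2 * \sum_x G x ^+ 2 <= (energy_vs F W2 - energy_vs F W1) * #|{: V}|%:R.
Proof.
move=> /subvP sW Ginv G1 FG; rewrite !energyE -mulrBl.
have V0 : 0 < #|{: V}|%:R :> R by rewrite ltr0n; apply/card_gt0P; exists 0.
rewrite divfK ?gt_eqF//.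
have P21 : \sum_x proj W2 F x * proj W1 F x = \sum_x proj W1 F x ^+ 2.
  rewrite sum_proj => [|x h /sW hW]; last exact: proj_inv.
  rewrite -(@sum_proj W1) => [|x h hW]; last exact: proj_inv.
  by apply: eq_bigr => x _; rewrite expr2.
have P2G : \sum_x proj W2 F x * G x = a * \sum_x G x ^+ 2 by rewrite sum_proj.
have : 0 <= \sum_x (proj W2 F x - proj W1 F x - a * G x) ^+ 2.
  by apply: sumr_ge0 => x _; exact: sqr_ge0.
have -> : \sum_x (proj W2 F x - proj W1 F x - a * G x) ^+ 2 =
    \sum_x proj W2 F x ^+ 2 + \sum_x proj W1 F x ^+ 2 + a ^+ 2 * \sum_x G x ^+ 2
    - 2 * \sum_x proj W2 F x * proj W1 F x
    - 2 * a * \sum_x proj W2 F x * G x + 2 * a * \sum_x proj W1 F x * G x.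
  rewrite !mulr_sumr -!sumrN -!big_split/=; apply: eq_bigr => x _.
  by ring.
by rewrite P21 P2G G1; lra.
Qed.

End Averages.

(* The flag H 0 >= H 1 >= ... consists of the subspaces on which the first
   coordinates vanish, and xi j x is the frequency used on the coset of H j
   through x. *)
Record frequency_system (R : realType) (p n B : nat)
    (H : nat -> pred 'rV['F_p]_n) (xi : nat -> 'rV['F_p]_n -> 'rV['F_p]_n) :
    Prop := FrequencySystem {
  flag_line : forall j h k t, H j h -> H j k -> H j (h + t *: k);
  flag_dec : forall i j h, (i <= j)%N -> H j h -> H i h;
  xi_inv : forall j x h, (j < B)%N -> H j h -> xi j (x + h) = xi j x;
  xi_perp : forall j x h, (j < B)%N -> H j.+1 h -> dotp (xi j x) h = 0;
  xi_many : forall j h, (j < B)%N -> H j h -> ~~ H j.+1 h ->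
    3 / 8 * #|{: 'rV['F_p]_n}|%:R <= #|[pred x | dotp (xi j x) h != 0]|%:R :> R;
  xi_ex : forall j x, (j < B)%N -> exists2 h, H j h & dotp (xi j x) h != 0 }.

(** * Correlation of a sum of waves with a single truncated wave *)

Section Core.
Variables (R : realType) (p n B : nat).
Hypothesis p_pr : prime p.
Local Notation V := 'rV['F_p]_n.
Variables (H : nat -> pred V) (xi : nat -> V -> V).
Hypothesis sys : frequency_system R B H xi.
Variable a : nat -> R.

Definition wave j (x : V) : R := psi R (dotp (xi j x) x).

Definition wave_sum (x : V) : R := 2^-1 + \sum_(j < B) a j * wave j x.

(** The h of the overview. The points with [dotp (xi j x) v] zero are dropped because there, for [v]
    in [H j], the wave is constant along [v] and would not average out. *)
Definition test j v (x : V) : R :=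
  if dotp (xi j x) v != 0 then wave j x else 0.

Lemma flag_lineZ j k t : H j k -> H j (t *: k).
Proof.
move=> Hk; rewrite -[t *: k]add0r -[0](subrr k) -scaleN1r.
exact/(flag_line sys)/Hk/(flag_line sys).
Qed.

Lemma wave_inv j x h : (j < B)%N -> H j.+1 h -> wave j (x + h) = wave j x.
Proof.
move=> jB Hh; have Hjh : H j h by exact: (flag_dec sys (leqnSn j)).
by rewrite /wave (xi_inv sys)// dotpDr (xi_perp sys _ jB Hh) addr0.
Qed.

Lemma test_inv j v x h : (j < B)%N -> H j.+1 h -> test j v (x + h) = test j v x.
Proof.
move=> jB Hh; have Hjh : H j h by exact: (flag_dec sys (leqnSn j)).
by rewrite /test (xi_inv sys)// wave_inv.
Qed.

Lemma test_line j v x t : (j < B)%N -> H j v ->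
  test j v (x + t *: v) =
  if dotp (xi j x) v != 0
  then psi R (dotp (xi j x) x + t * dotp (xi j x) v) else 0.
Proof.
move=> jB Hv; have Htv := flag_lineZ t Hv.
by rewrite /test /wave !(xi_inv sys)// dotpDr dotpZr.
Qed.

Lemma sum_test_inv j v (phi : V -> R) : (j < B)%N -> H j v ->
  (forall x t, phi (x + t *: v) = phi x) -> \sum_x phi x * test j v x = 0.
Proof.
move=> jB Hv phi_inv; have p0 : p%:R != 0 :> R by rewrite pnatr_eq0 -lt0n prime_gt0.
apply: (mulfI p0); rewrite mulr0 (sum_line p_pr _ v) big1// => x _.
under eq_bigr do rewrite phi_inv test_line//.
rewrite -mulr_sumr; case: (dotp (xi j x) v =P 0) => [_|/eqP xv] /=.
  by rewrite big1 ?mulr0.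
by rewrite (sum_affine (@psi R p))// sum_psi// mulr0.
Qed.

(** [test j v] is invariant under [H k], which lies in [H j.+1], whereas on each coset of [H k] the
    wave has a constant frequency that is nontrivial on [H k], so it averages to 0. *)
Lemma sum_wave_test j k v : (j < k < B)%N -> H j v ->
  \sum_x wave k x * test j v x = 0.
Proof.
move=> /andP[jk kB] Hv; have jB := ltn_trans jk kB.
(* The flag is only known to be closed under lines; any point of [H k] then puts 0 in it. *)
have [h0 H0 _] := xi_ex sys 0 kB.
have H00 : H k 0 by rewrite -(scale0r h0) flag_lineZ.
have Hk_gt0 : #|H k|%:R != 0 :> R.
  by rewrite pnatr_eq0 -lt0n; apply/card_gt0P; exists 0.
apply: (mulfI Hk_gt0); rewrite mulr0 mulr_natl -sumr_const.
rewrite (eq_bigr (fun h => \sum_x wave k (x + h) * test j v x)) => [|h Hh].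
  rewrite exchange_big big1//= => x _; rewrite -mulr_suml.
  have [k0 Hk0 xk0] := xi_ex sys x kB.
  rewrite [X in X * _](_ : _ = 0) ?mul0r//.
  under eq_bigr => h Hh do rewrite /wave (xi_inv sys)// dotpDr.
  by apply: (sum_psi_subspace R p_pr _ _ xk0) => // h t Hh; exact: (flag_line sys).
rewrite -(sum_shift (fun x => wave k x * test j v x) h).
apply: eq_bigr => x _; congr (_ * _).
by rewrite test_inv//; exact: (flag_dec sys jk).
Qed.

(** The identity <f, h> = a_j |h|^2. The constant and the levels below [j] are constant along [v],
    the levels above average out, and at level [j] wave times test is the square of the test. *)
Lemma wave_sum_test j v : (j < B)%N -> H j v ->
  \sum_x wave_sum x * test j v x = a j * \sum_x test j v x ^+ 2.
Proof.
move=> jB Hv; pose jo := Ordinal jB.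
under eq_bigr do rewrite mulrDl mulr_suml.
rewrite big_split/= (@sum_test_inv j v (fun=> 2^-1))// add0r exchange_big/=.
rewrite (bigD1 jo)//= [X in _ + X]big1 => [|k k_neq]; last first.
  under eq_bigr do rewrite -mulrA.
  rewrite -mulr_sumr; have [jk|kj] := ltnP j k.
    by rewrite sum_wave_test ?mulr0// jk ltn_ord.
  rewrite sum_test_inv ?mulr0// => x t; rewrite wave_inv//.
  apply: (flag_dec sys _ (flag_lineZ t Hv)).
  by rewrite ltn_neqAle kj andbT; apply: contra_neq k_neq => kj_eq; exact: val_inj.
rewrite addr0 mulr_sumr; apply: eq_bigr => x _.
by rewrite -mulrA /test; case: ifP; rewrite ?mulr0 ?expr0n ?mulr0 ?expr2.
Qed.

Lemma sum_test_sq j v : (j < B)%N -> H j v ->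
  #|[pred x | dotp (xi j x) v != 0]|%:R / 2 <= \sum_x test j v x ^+ 2.
Proof.
move=> jB Hv; have p0 : 0 < p%:R :> R by rewrite ltr0n prime_gt0.
rewrite -(ler_pM2l p0) (sum_line p_pr _ v) -sum1_card natr_sum.
rewrite mulrCA mulr_suml big_mkcond/=; apply: ler_sum => x _.
under eq_bigr do rewrite test_line//.
rewrite inE; case: (dotp (xi j x) v =P 0) => [_|/eqP xv] /=.
  by apply: sumr_ge0 => t _; exact: sqr_ge0.
by rewrite (sum_affine (fun t => @psi R p t ^+ 2))// mul1r sum_psi_sq.
Qed.

Lemma uniform_amplitude (eps : R) j (W : {vspace V}) v : (j < B)%N ->
  (forall x, 0 <= wave_sum x <= 1) -> 0 <= eps -> regular eps wave_sum W ->
  (forall h, h \in W -> H j h) -> v \in W -> ~~ H j.+1 v ->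
  3 * a j <= 22 * eps.
Proof.
move=> jB f01 eps_ge0 Wreg WH vW Hv; have Hjv := WH _ vW.
pose G := [pred x | dotp (xi j x) v != 0]; pose f := wave_sum.
pose T c := avg (coset W c) (fun x => (f x - avg (coset W c) f)
                                      * psi R (dotp (xi j c) x)).
have W0 := card_vspace_gt0 R W.
(* Subtracting the mean changes nothing: [v] lies in [W] and [dotp (xi j c) v] is nonzero, so the
   cosine sums to 0 over the coset. *)
have TE c : G c -> T c = (\sum_(h in W) f (c + h) * wave j (c + h)) / #|W|%:R.
  move=> Gc; rewrite /T avg_coset; congr (_ / _).
  under eq_bigr do rewrite mulrBl.
  rewrite sumrB -mulr_sumr.
  under [X in _ - _ * X]eq_bigr do rewrite dotpDr.
  rewrite (sum_psi_subspace R p_pr _ _ Gc)// => [|h t hW]; last first.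
    by rewrite memvD ?memvZ.
  rewrite mulr0 subr0; apply: eq_bigr => h hW.
  by rewrite /wave (xi_inv sys)// WH.
have sumT : \sum_(c | G c) T c = a j * \sum_x test j v x ^+ 2.
  under eq_bigr => c Gc do rewrite TE//.
  rewrite -mulr_suml exchange_big/= -(wave_sum_test jB Hjv).
  (* For fixed [h], shifting [c] by [h] preserves [xi j c], hence [G], so every [h] contributes the
     full pairing with [test j v]. *)
  rewrite (eq_bigr (fun=> \sum_x f x * test j v x)) => [|h hW].
    by rewrite sumr_const -[X in X / _]mulr_natr mulfK// gt_eqF.
  rewrite -(sum_shift _ h) big_mkcond/=; apply: eq_bigr => c _.
  by rewrite /test (xi_inv sys)// ?WH//; case: ifP => _; rewrite ?mulr0.
pose N := #|{: V}|%:R : R; pose g := #|G|%:R : R.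
have N0 : 0 < N by rewrite ltr0n; apply/card_gt0P; exists 0.
(* A non-uniform coset costs at most 1, since f and its averages lie in [0, 1]. *)
have T_le c : T c <= eps + (~~ uniform_on eps f W c)%:R.
  have [unif|_] /= := boolP (uniform_on eps f W c).
    by rewrite addr0; exact: Re_uniform.
  rewrite ler_wpDl// (le_trans (ler_norm _))// avg_cosetN1// => x.
  rewrite normrM mulr_ile1// ?psi_abs_le1//.
  by have := avg_coset_itv W c f01; have := f01 x; rewrite ler_norml /f; lra.
have sumT_le : \sum_(c | G c) T c <= eps * g + eps * N.
  rewrite (le_trans (ler_sum _ (fun c _ => T_le c)))// big_split/= lerD//.
    by rewrite sumr_const mulr_natr.
  apply: le_trans Wreg; rewrite -sum1_card natr_sum big_mkcond [leRHS]big_mkcond.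
  by apply: ler_sum => c _; rewrite inE; do 2 case: ifP.
(* From here a_j g / 2 <= eps (g + N) <= 11/3 eps g, which is the source of 22/3. *)
have g_ge : 3 / 8 * N <= g by exact: (xi_many sys).
have S_ge := sum_test_sq jB Hjv; rewrite -/g in S_ge.
have [a_lt0|a_ge0] := ltP (a j) 0; first by lra.
rewrite sumT in sumT_le.
have := ler_wpM2l a_ge0 S_ge => aS.
have epsN : eps * N <= eps * (8 / 3 * g) by apply: ler_wpM2l => //; lra.
have g0 : 0 < g by lra.
by rewrite -(ler_pM2r g0); lra.
Qed.

(** [test j u] is [W2]-invariant and, as [u] lies in [W1], orthogonal to [proj W1]. The factor 3/16
    is the proportion 3/8 times the mean square 1/2 of the cosine. *)
Lemma energy_amplitude j (W1 W2 : {vspace V}) u : (j < B)%N ->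
  (W2 <= W1)%VS -> (forall h, h \in W2 -> H j.+1 h) ->
  u \in W1 -> H j u -> ~~ H j.+1 u ->
  3 / 16 * a j ^+ 2 <= energy_vs wave_sum W2 - energy_vs wave_sum W1.
Proof.
move=> jB sW W2H uW1 Hu Hu'; pose N := #|{: V}|%:R : R.
have N0 : 0 < N by rewrite ltr0n; apply/card_gt0P; exists 0.
rewrite -(ler_pM2r N0).
have gap := energy_gap sW (fun x h hW => test_inv u x jB (W2H h hW))
  (sum_test_inv jB Hu (fun x t => proj_inv wave_sum x (memvZ t uW1)))
  (wave_sum_test jB Hu).
apply: le_trans gap; have S_ge := sum_test_sq jB Hu.
have g_ge := xi_many sys jB Hu Hu'.
rewrite [3 / 16 * _]mulrC -mulrA; apply: ler_wpM2l; first exact: sqr_ge0.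
by rewrite -/N in g_ge; lra.
Qed.

End Core.

(** The fibres of an equivariant map have equal size: count the pairs (x, t) with [Q (op (f x) t)]
    in two ways. It carries proportions from a block of coordinates to the whole space. *)
Lemma card_preim_equivariant (V : finZmodType) (T : finType)
    (op : T -> T -> T) (f : V -> T) (g : T -> V) (Q : pred T) :
  (forall x t, f (x + g t) = op (f x) t) -> (forall a, injective (op a)) ->
  (#|[pred x | Q (f x)]| * #|T| = #|V| * #|Q|)%N.
Proof.
move=> fop op_inj.
have sumT x : \sum_(t : T) (Q (op (f x) t) : nat) = #|Q|.
  rewrite -sum1_card [RHS]big_mkcond [RHS](reindex_inj (op_inj (f x))).
  by apply: eq_bigr => t _; rewrite unfold_in; case: (Q _).
have sumV t : \sum_(x : V) (Q (op (f x) t) : nat) = #|[pred x | Q (f x)]|.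
  rewrite -sum1_card [RHS]big_mkcond [RHS](reindex_inj (addIr (g t))).
  by apply: eq_bigr => x _; rewrite inE fop; case: (Q _).
rewrite mulnC -!sum_nat_const.
under eq_bigr => t _ do rewrite -(sumV t).
by rewrite exchange_big/=; apply: eq_bigr => x _; rewrite sumT.
Qed.

(** * Blocks of coordinates *)

Section Coordinates.
Variable p : nat.

(** Indexing by [nat], with value 0 out of range, avoids casts between ordinal types when blocks are
    cut out or glued. *)
Definition coord n (x : 'rV['F_p]_n) (k : nat) : 'F_p :=
  if insub k is Some i then x 0 i else 0.

Definition part n (off m : nat) (x : 'rV['F_p]_n) : 'rV['F_p]_m :=
  \row_i coord x (off + i).

Definition embed n (off m : nat) (v : 'rV['F_p]_m) : 'rV['F_p]_n :=
  \row_(k < n) if (off <= k)%N then coord v (k - off) else 0.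

Lemma coord_ord n (x : 'rV['F_p]_n) (i : 'I_n) : coord x i = x 0 i.
Proof. by rewrite /coord valK. Qed.

Lemma coord_out n (x : 'rV['F_p]_n) k : (n <= k)%N -> coord x k = 0.
Proof. by move=> nk; rewrite /coord insubF// ltnNge nk. Qed.

Lemma coordD n (x y : 'rV['F_p]_n) k : coord (x + y) k = coord x k + coord y k.
Proof. by rewrite /coord; case: insubP => [i _ _|_]; rewrite ?mxE ?addr0. Qed.

Lemma coordZ n t (x : 'rV['F_p]_n) k : coord (t *: x) k = t * coord x k.
Proof. by rewrite /coord; case: insubP => [i _ _|_]; rewrite ?mxE ?mulr0. Qed.

Lemma coord_part n off m (x : 'rV['F_p]_n) k : (k < m)%N ->
  coord (part off m x) k = coord x (off + k).
Proof. by move=> km; rewrite (coord_ord _ (Ordinal km)) mxE. Qed.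

Lemma coord_embed n off m (v : 'rV['F_p]_m) k : (k < n)%N ->
  coord (embed n off v) k = if (off <= k)%N then coord v (k - off) else 0.
Proof. by move=> kn; rewrite (coord_ord _ (Ordinal kn)) mxE. Qed.

Lemma coord_eqP n (x y : 'rV['F_p]_n) :
  (forall k, (k < n)%N -> coord x k = coord y k) -> x = y.
Proof. by move=> xy; apply/rowP => i; rewrite -!coord_ord xy. Qed.

Lemma partD n off m : {morph @part n off m : x y / x + y}.
Proof. by move=> x y; apply/rowP => i; rewrite !mxE coordD. Qed.

Lemma embedD n off m : {morph @embed n off m : x y / x + y}.
Proof.
by move=> x y; apply/rowP => i; rewrite !mxE coordD; case: ifP; rewrite ?addr0.
Qed.

Lemma embedK n off m : (off + m <= n)%N -> cancel (@embed n off m) (@part n off m).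
Proof.
move=> le_n v; apply: coord_eqP => k km.
by rewrite coord_part// coord_embed ?leq_addr ?addKn//; lia.
Qed.

Lemma dotp_coord n (r x : 'rV['F_p]_n) :
  dotp r x = \sum_(0 <= k < n) coord r k * coord x k.
Proof. by rewrite big_mkord; apply: eq_bigr => k _; rewrite !coord_ord. Qed.

Lemma dotp_embed n off m (v : 'rV['F_p]_m) (x : 'rV['F_p]_n) :
  (off + m <= n)%N -> dotp (embed n off v) x = dotp v (part off m x).
Proof.
move=> le_n; rewrite !dotp_coord.
rewrite (big_cat_nat (n := off))//=; last by lia.
rewrite big_nat_cond big1 ?add0r => [|k]; last first.
  rewrite andbT => /andP[_ k_off]; rewrite coord_embed; last by lia.
  by rewrite leqNgt k_off mul0r.
rewrite (big_cat_nat (n := off + m)) ?leq_addr//=.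
rewrite [X in _ + X]big_nat_cond [X in _ + X]big1 ?addr0 => [|k]; last first.
  rewrite andbT => /andP[k_off kn]; rewrite coord_embed//.
  by rewrite coord_out ?if_same ?mul0r//; lia.
rewrite -[X in \sum_(X <= _ < _) _]add0n big_addn addKn big_nat [RHS]big_nat.
apply: eq_bigr => k /andP[_ km].
by rewrite coord_embed ?leq_addl ?addnK 1?addnC ?coord_part//; lia.
Qed.

Lemma dotp_delta n (r : 'rV['F_p]_n) l : dotp r (delta_mx 0 l) = r 0 l.
Proof.
rewrite /dotp (bigD1 l)//= mxE !eqxx mulr1 big1 ?addr0// => k kl.
by rewrite mxE (negPf kl) andbF mulr0.
Qed.

Lemma dotp_nondegenerate n (r : 'rV['F_p]_n) : r != 0 ->
  exists x, dotp r x != 0.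
Proof.
case/rV0Pn => l rl; exists (delta_mx 0 l).
by rewrite dotp_delta.
Qed.

(** Over a prime field every scalar is a multiple of 1, so additive maps are linear. *)
Lemma additive_dotp d (f : 'rV['F_p]_d -> 'F_p) : {morph f : u v / u + v} ->
  {r | forall v, f v = dotp r v}.
Proof.
move=> fD; exists (\row_l f (delta_mx 0 l)) => v.
have f0 : f 0 = 0 by apply: (addrI (f 0)); rewrite -fD !addr0.
have fMn u k : f (u *+ k) = f u *+ k.
  by elim: k => [|k IHk]; rewrite ?f0// !mulrS fD IHk.
rewrite {1}[v]row_sum_delta (big_morph f fD f0); apply: eq_bigr => l _.
by rewrite mxE -(natr_Zp (v 0 l)) scaler_nat fMn mulr_natr.
Qed.

Definition flag (D n : nat) (x : 'rV['F_p]_n) : bool :=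
  [forall k : 'I_n, (k < D)%N ==> (x 0 k == 0)].

Lemma flagP D n (x : 'rV['F_p]_n) :
  reflect (forall k, (k < D)%N -> coord x k = 0) (flag D x).
Proof.
apply: (iffP forallP) => [x0 k kD|x0 k].
  have [kn|/coord_out//] := ltnP k n.
  by rewrite (coord_ord x (Ordinal kn)); apply/eqP/(implyP (x0 (Ordinal kn))).
by apply/implyP => kD; rewrite -coord_ord x0.
Qed.

(** Pigeonhole: otherwise (w, v) -> w + [embed n off v] is injective on the product of [W] and the
    block, which forces dim W + d <= n. *)
Lemma vspace_meets_block (p_pr : prime p) n off d (W : {vspace 'rV['F_p]_n}) :
  (off + d <= n)%N -> (codim W < d)%N ->
  exists2 v : 'rV['F_p]_d, v != 0 & embed n off v \in W.
Proof.
move=> le_n W_d; apply/exists_inP; apply: contraLR W_d.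
move=> /exists_inPn noW; rewrite -leqNgt /codim.
pose f (u : 'rV['F_p]_n * 'rV['F_p]_d) := u.1 + embed n off u.2.
pose S := setX [set w | w \in W] [set: 'rV['F_p]_d].
have f_inj : {in S &, injective f}.
  move=> [w v] [w' v']; rewrite !inE !andbT /= /f/= => wW w'W fE.
  have vE : v = v'.
    apply/eqP; rewrite -subr_eq0; apply/negP => /negP/noW.
    have -> : embed n off (v - v') = w' - w.
      by apply: (addIr (embed n off v')); rewrite -embedD subrK addrAC -fE addrC addKr.
    by rewrite rpredB.
  by move: fE; rewrite vE => /addIr ->.
have := subset_leq_card (subsetT (f @: S)); rewrite (card_in_imset f_inj).
rewrite cardsX !cardsT cardsE card_vspace !card_mx !mul1n card_Fp// -expnD.
rewrite leq_exp2l ?prime_gt1// => le_dim.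
rewrite leq_subRL; first exact: le_dim.
exact: leq_trans (leq_addr _ _) le_dim.
Qed.

End Coordinates.

(** * Codes with relative distance 3/8, and the frequencies built from them *)

Import VectorInternalTheory.

Section Code.
Variable p : nat.
Hypothesis p_pr : prime p.

Lemma finfield_coordinates m : (0 < m)%N ->
  {L : finFieldType & {theta : 'rV['F_p]_m -> L & {theta' : L -> 'rV['F_p]_m |
    [/\ {morph theta : u v / u + v}, {morph theta' : u v / u + v},
        cancel theta theta' & cancel theta' theta]}}}.
Proof.
move=> m0; have [L chL cardL] := pPrimePowerField p_pr m0.
pose Lv : vectType 'F_p := pPrimeCharType chL.
have dimE : dim Lv = m.
  apply: (@expnI p); first exact: prime_gt1.
  have <- : #|{: 'rV['F_p]_(dim Lv)}| = (p ^ dim Lv)%N.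
    by rewrite card_mx mul1n card_Fp.
  rewrite -cardL; apply/esym/(bij_eq_card (f := @v2r _ Lv)).
  by exists (@r2v _ Lv);
    [exact: v2rK | exact: r2vK].
exists L; rewrite -dimE; exists (@r2v _ Lv), (@v2r _ Lv).
have rD := linearD (r2v (vT := Lv)); have vD := linearD (v2r (vT := Lv)).
by split; [exact: rD | exact: vD | exact: r2vK
  | exact: v2rK].
Qed.

(** With m = D/2, this is room for the coefficients of a polynomial of degree at most p^m / 4 over
    the field with p^m elements, m coordinates each. Small [D] advances by one coordinate. *)
Definition width (D : nat) : nat :=
  if (D < 13)%N then 1 else (D./2 * (p ^ D./2 %/ 4).+1)%N.

(** The word of [v] has the letter [dotp (C y) v] at [y]; the code is linear, so its distance is its
    least nonzero weight. *)
Definition distance_code D d (C : 'rV['F_p]_D -> 'rV['F_p]_d) :=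
  forall v, v != 0 -> (3 * p ^ D <= 8 * #|[pred y | dotp (C y) v != 0%R]|)%N.

(** Translation by a basis vector not orthogonal to [w] injects the zeros into the nonzeros. *)
Lemma card_dotp_neq0 m (w : 'rV['F_p]_m) : w != 0 ->
  (p ^ m <= 2 * #|[pred b : 'rV['F_p]_m | dotp b w != 0%R]|)%N.
Proof.
case/rV0Pn => l wl; pose e : 'rV['F_p]_m := delta_mx 0 l.
have ew : dotp e w = w 0 l.
  by rewrite -dotp_delta; apply: eq_bigr => k _; rewrite mulrC.
pose Z := [pred b : 'rV['F_p]_m | dotp b w != 0].
have <- : (#|Z| + #|[predC Z]| = p ^ m)%N.
  by rewrite cardC card_mx mul1n card_Fp.
rewrite mul2n -addnn leq_add2l -(card_imset _ (addIr e)).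
apply: subset_leq_card; apply/subsetP => _ /imsetP[b /[!inE] + ->].
rewrite negbK => /eqP bw.
have -> : dotp (b + e) w = dotp b w + dotp e w.
  by rewrite -big_split; apply: eq_bigr => k _; rewrite mxE mulrDl.
by rewrite bw add0r ew.
Qed.

(* A Reed-Solomon code over the field with p ^ m elements, concatenated with
   the Hadamard code: the word of v has the letter dotp b (P_v a) at (a, b). *)
Lemma reed_solomon_code D : (13 <= D)%N ->
  {C : 'rV['F_p]_D -> 'rV['F_p]_(width D) | distance_code C}.
Proof.
move=> D13; rewrite /width ltnNge D13 /=.
set m := D./2; set k := (_ %/ 4).+1.
have m0 : (0 < m)%N by rewrite /m; lia.
have mD : (m + m <= D)%N by rewrite /m; lia.
have k_le : (4 * k <= p ^ m + 4)%N.
  by rewrite mulnS addnC leq_add2r mulnC leq_divM.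
clearbody k m.
have [L [th [th' [thD th'D thK th'K]]]] := finfield_coordinates m0.
have th0 : th 0 = 0 by apply: (addrI (th 0)); rewrite -thD !addr0.
pose P (v : 'rV['F_p]_(m * k)) := \poly_(i < k) th (part (i * m) m v).
have PD : {morph P : u v / u + v}.
  by move=> u v; apply/polyP => i; rewrite coefD !coef_poly partD thD;
    case: ifP; rewrite ?addr0.
pose phi (ab : 'rV['F_p]_m * 'rV['F_p]_m) v := dotp ab.2 (th' (P v).[th ab.1]).
have phiD ab : {morph phi ab : u v / u + v}.
  by move=> u v; rewrite /phi PD hornerD th'D dotpDr.
pose split (y : 'rV['F_p]_D) : 'rV['F_p]_m * 'rV['F_p]_m := (part 0 m y, part m m y).
exists (fun y : 'rV['F_p]_D => sval (additive_dotp (phiD (split y)))) => v v0.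
pose Q := [pred ab | phi ab v != 0].
rewrite (eq_card (B := [pred y | Q (split y)])) => [|y]; last first.
  by rewrite !inE -(svalP (additive_dotp (phiD (split y)))).
have Pv0 : P v != 0.
  apply: contra_neq v0 => Pv; apply/rowP => l; rewrite mxE -coord_ord.
  have lk : (l %/ m < k)%N by rewrite ltn_divLR// [(k * m)%N]mulnC ltn_ord.
  have := congr1 (fun q : {poly L} => th' q`_(l %/ m)) Pv.
  rewrite coef_poly lk coef0 thK -th0 thK => part0.
  rewrite (divn_eq l m) -(@coord_part _ _ _ m) ?ltn_mod// part0.
  by rewrite /coord; case: insubP => // i _ _; rewrite mxE.
pose good := [pred x : 'rV['F_p]_m | (P v).[th x] != 0].
have good_card : (3 * p ^ m <= 4 * #|good|)%N.
  (* A nonzero polynomial with [k] coefficients has fewer than [k] roots, hence at most p^m / 4. *)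
  have bad_lt : (#|[predC good]| < k)%N.
    have bad_roots : all (root (P v)) [seq th x | x in [predC good]].
      apply/allP => _ /imageP[x /[!inE] + ->].
      by rewrite negbK.
    have := max_poly_roots Pv0 bad_roots.
    rewrite size_map -cardE => /(_ _)/leq_trans; apply; last exact: size_poly.
    by rewrite map_inj_uniq ?enum_uniq//; exact: can_inj thK.
  have : (#|good| + #|[predC good]| = p ^ m)%N.
    by rewrite cardC card_mx mul1n card_Fp.
  by move: k_le bad_lt; move: #|good| #|[predC good]| => u w; lia.
(* 3/8 is 3/4 from the polynomial times 1/2 from the Hadamard part. *)
have Q_card : (3 * p ^ (m + m) <= 8 * #|Q|)%N.
  pose supp x := [pred b | dotp b (th' (P v).[th x]) != 0].
  have -> : #|Q| = (\sum_(x in good) #|supp x|)%N.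
    have th'0 : th' 0 = 0 by apply: (addrI (th' 0)); rewrite -th'D !addr0.
    under [RHS]eq_bigr do rewrite -sum1_card.
    rewrite -sum1_card pair_big_dep; apply: eq_bigl => -[x b] /=.
    rewrite !inE /phi /=; have [->|//] := eqVneq (P v).[th x] 0.
    by rewrite th'0 dotp0 eqxx.
  have : (\sum_(x in good) p ^ m <= \sum_(x in good) 2 * #|supp x|)%N.
    apply: leq_sum => x gx; apply: card_dotp_neq0.
    apply: contra_neq gx => Px.
    by rewrite -(th'K (P v).[th x]) Px th0.
  rewrite sum_nat_const -big_distrr/= expnD mulnA => le_sum.
  apply: leq_trans (leq_mul good_card (leqnn _)) _.
  by rewrite -mulnA -[X in (_ <= X * _)%N]/(4 * 2)%N -mulnA leq_mul2l.
(* For odd [D] the map [split] is not injective; [glue] makes it equivariant, so its fibres have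
   equal size. *)
pose glue (ab : 'rV['F_p]_m * 'rV['F_p]_m) : 'rV['F_p]_D :=
  embed D 0 ab.1 + embed D m ab.2.
have m_D : (m <= D)%N by rewrite (leq_trans _ mD)// leq_addr.
have part0m (b : 'rV['F_p]_m) : part 0 m (embed D m b) = 0.
  apply/rowP => l; rewrite !mxE coord_embed; last first.
    by rewrite add0n (leq_trans (ltn_ord l)).
  by rewrite add0n leqNgt ltn_ord.
have partm0 (x : 'rV['F_p]_m) : part m m (embed D 0 x) = 0.
  apply/rowP => l; rewrite !mxE coord_embed; last first.
    by apply: leq_trans mD; rewrite ltn_add2l.
  by rewrite leq0n subn0 coord_out// leq_addr.
pose op (a b : 'rV['F_p]_m * 'rV['F_p]_m) := (a.1 + b.1, a.2 + b.2).
have split_glue y ab : split (y + glue ab) = op (split y) ab.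
  by rewrite /split /glue !partD part0m partm0 addr0 add0r !embedK.
have op_inj a : injective (op a) by move=> [b c] [b' c'] [/addrI -> /addrI ->].
have := card_preim_equivariant (Q : pred _) split_glue op_inj.
rewrite card_prod !card_mx !mul1n card_Fp// -expnD => fibE.
have pm0 : (0 < p ^ (m + m))%N by rewrite expn_gt0 prime_gt0.
by rewrite -(leq_pmul2r pm0) -[leqRHS]mulnA fibE [leqLHS]mulnAC
  [leqLHS]mulnC [leqRHS]mulnCA leq_mul2l Q_card orbT.
Qed.

Lemma width_gt0 D : (0 < width D)%N.
Proof. rewrite /width; case: (ltnP D 13) => // D13; rewrite muln_gt0 andbT half_gt0.
exact: leq_trans D13. Qed.

(** Replacing the zero values of [C] by the all-ones vector can only enlarge the weights, and yields
    the nonzero frequencies behind [xi_ex]. *)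
Lemma code_exists D : {C : 'rV['F_p]_D -> 'rV['F_p]_(width D) |
  distance_code C & forall y, C y != 0}.
Proof.
have [C codeC] : {C : 'rV['F_p]_D -> 'rV['F_p]_(width D) | distance_code C}.
  have [D13|] := ltnP D 13; last exact: reed_solomon_code.
  exists (fun=> const_mx 1) => v /rV0Pn[i vi].
  rewrite (eq_card (B := predT)) ?cardE => [|y].
    by rewrite -cardT card_mx mul1n card_Fp// leq_mul2r orbT.
  rewrite !inE; suff -> : dotp (const_mx 1) v = v 0 i by [].
  have jE (j : 'I_(width D)) : j = i.
    have w1 : (width D <= 1)%N by rewrite /width D13.
    have := leq_trans (ltn_ord i) w1; have := leq_trans (ltn_ord j) w1.
    by rewrite !ltnS !leqn0 => /eqP j0 /eqP i0; apply: val_inj; rewrite /= j0.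
  rewrite /dotp (bigD1 i)//= mxE mul1r big1 ?addr0// => j.
  by rewrite (jE j) eqxx.
pose e : 'rV['F_p]_(width D) := const_mx 1.
exists (fun y => if C y == 0 then e else C y) => [v v0|y].
  apply: leq_trans (codeC v v0) _; rewrite leq_mul2l/=.
  apply: subset_leq_card; apply/subsetP => y; rewrite !inE.
  have [->|//] := eqVneq (C y) 0.
  have -> : dotp 0 v = 0 by apply: big1 => k _; rewrite mxE mul0r.
  by rewrite eqxx.
case: ifPn => // _; apply/rV0Pn; exists (Ordinal (width_gt0 D)).
by rewrite mxE oner_eq0.
Qed.

Definition code D := s2val (code_exists D).

Fixpoint dims (j : nat) : nat := if j is i.+1 then (dims i + width (dims i))%N else 0%N.

Lemma dims_le i j : (i <= j)%N -> (dims i <= dims j)%N.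
Proof.
move=> /subnK <-; elim: (j - i)%N => // k IHk.
by rewrite addSn /= (leq_trans IHk)// leq_addr.
Qed.

Definition frequency n j (x : 'rV['F_p]_n) : 'rV['F_p]_n :=
  embed n (dims j) (code (part 0 (dims j) x)).

Lemma frequency_systemP (R : realType) n B : (dims B <= n)%N ->
  frequency_system R B (fun j => @flag p (dims j) n) (@frequency n).
Proof.
move=> le_n.
have dims_n j : (j < B)%N -> (dims j + width (dims j) <= n)%N.
  by move=> jB; rewrite (leq_trans _ le_n)// -[leqLHS]/(dims j.+1) dims_le.
have dotpE j (x h : 'rV['F_p]_n) : (j < B)%N -> dotp (frequency j x) h =
    dotp (code (part 0 (dims j) x)) (part (dims j) (width (dims j)) h).
  by move=> jB; apply: dotp_embed; exact: dims_n.
split.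
- move=> j h k t /flagP Hh /flagP Hk; apply/flagP => l lj.
  by rewrite coordD coordZ Hh// Hk// mulr0 addr0.
- move=> i j h ij /flagP Hh; apply/flagP => l li.
  by rewrite Hh// (leq_trans li) ?dims_le.
- move=> j x h jB /flagP Hh; congr (embed _ _ (code _)).
  rewrite partD [X in _ + X](_ : _ = 0) ?addr0//; apply/rowP => l.
  by rewrite !mxE add0n Hh.
- move=> j x h jB /flagP Hh; rewrite dotpE//.
  rewrite (_ : part _ _ h = 0) ?dotp0//; apply/rowP => l.
  by rewrite !mxE Hh//= ltn_add2l.
- move=> j h jB /flagP Hh /flagP Hh'.
  pose v := part (dims j) (width (dims j)) h.
  have v0 : v != 0.
    apply/eqP => v0; apply: Hh' => k; have [/Hh//|jk] := ltnP k (dims j).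
    rewrite /= -{1}(subnKC jk) ltn_add2l => k_w.
    by rewrite -{1}(subnKC jk) -(coord_part _ _ k_w) -/v v0 /coord;
      case: insubP => // i _ _; rewrite mxE.
  have jn : (dims j <= n)%N by rewrite (leq_trans _ (dims_n _ jB))// leq_addr.
  have := s2valP (code_exists (dims j)) v v0.
  pose Q := [pred y | dotp (code y) v != 0]; rewrite -/(code _) -[X in #|X|]/Q.
  have part_embed (x : 'rV['F_p]_n) (y : 'rV['F_p]_(dims j)) :
      part 0 (dims j) (x + embed n 0 y) = part 0 (dims j) x + y.
    by rewrite partD embedK.
  (* The proportion 3/8 passes from the first [dims j] coordinates to all [n]. *)
  have := card_preim_equivariant (Q : pred _) part_embed (@addrI _).
  rewrite (eq_card (B := [pred x | dotp (frequency j x) h != 0])) => [|x]; last first.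
    by rewrite !inE dotpE.
  rewrite !card_mx !mul1n !card_Fp// => fibE codeE.
  have pm0 : (0 < p ^ dims j)%N by rewrite expn_gt0 prime_gt0.
  have : (3 * p ^ n <= 8 * #|[pred x | dotp (frequency j x) h != 0%R]|)%N.
    by rewrite -(leq_pmul2r pm0) -[leqRHS]mulnA fibE [leqLHS]mulnAC
  [leqLHS]mulnC [leqRHS]mulnCA leq_mul2l codeE orbT.
  by rewrite -(ler_nat R) !natrM => le_R; lra.
- move=> j x jB; have := s2valP' (code_exists (dims j)) (part 0 (dims j) x).
  move=> /dotp_nondegenerate[v xv]; exists (embed n (dims j) v).
    apply/flagP => k kj; have [kn|/coord_out->//] := ltnP k n.
    by rewrite coord_embed// leqNgt kj.
  by rewrite dotpE// embedK ?dims_n.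
Qed.

End Code.

(** * Tower growth of the codimensions *)

Lemma twr_le i j : (i <= j)%N -> (twr i <= twr j)%N.
Proof.
move=> /subnK <-; elim: (j - i)%N => // k IHk.
by rewrite addSn /= (leq_trans IHk)// ltnW// ltn_expl.
Qed.

Section Growth.
Variable p : nat.
Hypothesis p_pr : prime p.

Lemma width_exp D : (13 <= D)%N -> (2 ^ D./2 <= width p D)%N.
Proof.
move=> D13; rewrite /width [(D < 13)%N]ltnNge D13/=.
have m6 : (6 <= D./2)%N by have := half_leq D13.
have pm : (2 ^ D./2 <= p ^ D./2)%N by rewrite leq_exp2r ?prime_gt1// (leq_trans _ m6).
apply: leq_trans (pm) _; move: (D./2) m6 pm => m m6 _; move: (p ^ m)%N => P.
rewrite -(leq_pmul2r (isT : 0 < 4)%N) mulnAC -mulnA.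
rewrite (leq_trans (n := m * P)) ?leq_mul2l//; first by rewrite mulnC leq_mul2r; lia.
by have := ltn_ceil P (isT : 0 < 4)%N; lia.
Qed.

(** Lets [vspace_meets_block] apply to any subspace of codimension at most [D]. *)
Lemma width_gt D : (13 <= D)%N -> (D < width p D)%N.
Proof.
move=> D13; rewrite /width [(D < 13)%N]ltnNge D13/=.
have m6 : (6 <= D./2)%N by have := half_leq D13.
have P16 : (16 <= p ^ D./2 %/ 4)%N.
  rewrite (_ : 16 = 2 ^ 6 %/ 4)%N// leq_div2r//.
  rewrite (leq_trans (n := p ^ 6)) ?leq_exp2r ?prime_gt1//.
  by rewrite leq_exp2l ?prime_gt1.
rewrite (leq_trans (n := D./2 * 17)) ?leq_mul2l ?ltnS ?P16 ?orbT//.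
by have := odd_double_half D; lia.
Qed.

Lemma dims_ge j : (j <= dims p j)%N.
Proof.
elim: j => //= j IHj; have := width_gt0 p (dims p j); lia.
Qed.

(** The bound 4 t + 9 reproduces itself: it gives D/2 >= t + 4, and 2^(t + 4) >= 4 * 2^t + 9. At
    [i = 0] it is 13. *)
Lemma dims_tower j i : (13 <= dims p j)%N ->
  (4 * twr i + 9 <= dims p (j + i))%N.
Proof.
move=> D13; elim: i => [|i IHi]; first by rewrite addn0.
rewrite [(j + _)%N]addnS /=; set D := dims p (j + i) in IHi *; set t := twr i in IHi *.
have D13' : (13 <= D)%N by rewrite (leq_trans D13)// dims_le// leq_addr.
apply: (leq_trans _ (leq_addl _ _)).
apply: (leq_trans _ (width_exp D13')).
have le_m : (t + 4 <= D./2)%N by lia.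
apply: (leq_trans (n := 2 ^ (t + 4))); last by rewrite leq_exp2l.
by rewrite expnD; have := expn_gt0 2 t; lia.
Qed.

End Growth.

(** * The amplitudes and their total *)

Section Amplitudes.
Variables (R : realType) (p : nat) (delta : R).
Hypothesis p_pr : prime p.
Local Notation sd := (Num.sqrt delta).

(** 3/32 is 15/2 times the 1/80 in the bound on epsilon, and 15/2 exceeds 22/3. *)
Definition small_amp (e : nat) : R := 3 / 32 * sd / (p%:R ^+ 2 * (e%:R + 1)).

(** Chosen so that 3/16 * (5/2)^2 = 75/64 exceeds 1. *)
Definition big_amp : R := 5 / 2 * sd.

(* Stage k forces the subspace through a tower of height about e, where e is the
   dimension handled by the previous stages, and ends with a level whose
   amplitude alone carries energy more than delta. *)
Fixpoint amps (k : nat) : seq R :=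
  if k is k'.+1 then
    let e := dims p (size (amps k')).-1 in
    amps k' ++ rcons (nseq (e + 13) (small_amp e)) big_amp
  else [::].

(** The e_k of the overview: the predecessor stops just before the big level that closes the
    previous stage. [stage_dim 0] is 0. *)
Definition stage_dim k := dims p (size (amps k)).-1.

Lemma size_ampsS k : size (amps k.+1) = (size (amps k) + (stage_dim k + 13)).+1.
Proof. by rewrite /= size_cat size_rcons size_nseq addnS. Qed.

Lemma stage_dimS k : stage_dim k.+1 = dims p (size (amps k) + (stage_dim k + 13)).
Proof. by rewrite {1}/stage_dim size_ampsS. Qed.

Lemma stage_dim_ge13 k : (13 <= stage_dim k.+1)%N.
Proof. by rewrite stage_dimS (leq_trans _ (dims_ge p_pr _))//; lia. Qed.

Lemma stage_dim_le k : (stage_dim k <= stage_dim k.+1)%N.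
Proof. by rewrite stage_dimS dims_le//; lia. Qed.

(** The first stage reaches dimension 13 by its 13 extra levels; each later one has more small
    levels than its starting dimension, so it applies [twr] at least once. *)
Lemma wwz_stage_dim k : (wwz k <= stage_dim k.+1)%N.
Proof.
elim: k => [|k IHk]; first by rewrite (leq_trans _ (stage_dim_ge13 0)).
rewrite /= (leq_trans (twr_le IHk))//.
have := dims_tower p_pr (stage_dim k.+1) (stage_dim_ge13 k).
rewrite -/(stage_dim _) (stage_dimS k.+1).
set t := twr _ => le_dims; have : (t <= 4 * t + 9)%N by lia.
by move=> /leq_trans; apply; rewrite (leq_trans le_dims)// dims_le//; lia.
Qed.

Hypothesis delta_gt0 : 0 < delta.

Let sd_gt0 : 0 < sd. Proof. by rewrite sqrtr_gt0. Qed.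

Let p2_ge4 : 4 <= p%:R ^+ 2 :> R.
Proof.
have p2 : 2 <= p%:R :> R by rewrite ler_nat prime_gt1.
by nra.
Qed.

Lemma small_amp_gt0 e : 0 < small_amp e.
Proof.
have e1 : 0 < e%:R + 1 :> R by rewrite ltr_wpDl.
have p2_gt0 : 0 < p%:R ^+ 2 :> R by exact: lt_le_trans p2_ge4.
by apply: divr_gt0; apply: mulr_gt0 => //; lra.
Qed.

Lemma small_amp_le e e' : (e <= e')%N -> small_amp e' <= small_amp e.
Proof.
move=> ee'; have e1 : 0 < e%:R + 1 :> R by rewrite ltr_wpDl.
have p2_gt0 : 0 < p%:R ^+ 2 :> R by exact: lt_le_trans p2_ge4.
have e1' : 0 < e'%:R + 1 :> R by rewrite ltr_wpDl.
apply: ler_wpM2l; first by have := sd_gt0; lra.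
rewrite lef_pV2 ?posrE ?(mulr_gt0 p2_gt0)//.
by rewrite ler_pM2l// lerD2r ler_nat.
Qed.

Lemma small_amp_mul e : (e%:R + 1) * small_amp e <= 3 / 128 * sd.
Proof.
have e1 : e%:R + 1 != 0 :> R by rewrite gt_eqF// ltr_wpDl.
have p2_gt0 : 0 < p%:R ^+ 2 :> R by exact: lt_le_trans p2_ge4.
have -> : (e%:R + 1) * small_amp e = 3 / 32 * sd / p%:R ^+ 2.
  by rewrite /small_amp; field; rewrite e1; move: p2_gt0;
    rewrite lt0r sqrf_eq0 => /andP[->].
by rewrite ler_pdivrMr//; have := ler_wpM2l (ltW sd_gt0) p2_ge4; lra.
Qed.

Lemma small_le_big e : small_amp e <= big_amp.
Proof.
apply: le_trans (small_amp_le (leq0n e)) _.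
by have := small_amp_mul 0; have := sd_gt0; rewrite mulr0n add0r mul1r /big_amp; lra.
Qed.

Lemma amps_ge k : {in amps k.+1, forall x, small_amp (stage_dim k) <= x}.
Proof.
have amps_ge' : {in amps k, forall x, small_amp (stage_dim k) <= x}.
  elim: k => // k IHk x; rewrite mem_cat mem_rcons inE mem_nseq.
  case/or3P => [/IHk|/eqP->|/andP[_ /eqP->]]; last 2 first.
  - exact: small_le_big.
  - exact/small_amp_le/stage_dim_le.
  - exact/le_trans/small_amp_le/stage_dim_le.
move=> x; rewrite mem_cat mem_rcons inE mem_nseq.
by case/or3P => [/amps_ge'//|/eqP->|/andP[_ /eqP->]]; rewrite ?small_le_big.
Qed.

Lemma size_amps_le k K : (k <= K)%N -> (size (amps k) <= size (amps K))%N.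
Proof.
move=> /subnK <-; elim: (K - k)%N => // i IHi.
by rewrite (leq_trans IHi)// addSn /= size_cat leq_addr.
Qed.

Lemma nth_amps k K j : (k <= K)%N -> (j < size (amps k))%N ->
  nth 0 (amps K) j = nth 0 (amps k) j.
Proof.
move=> /subnK <- jk; elim: (K - k)%N => // i <-.
rewrite addSn /= nth_cat; case: ltnP => // le_j.
by have := leq_trans jk (size_amps_le (leq_addl i k)); rewrite ltnNge le_j.
Qed.

Lemma last_amps k : nth 0 (amps k.+1) (size (amps k.+1)).-1 = big_amp.
Proof. by rewrite nth_last /= last_cat last_rcons. Qed.

(** A stage costs at most 13 (e + 1) [small_amp e] + [big_amp], that is (39/128 + 5/2) sqrt delta <
    3 sqrt delta. *)
Lemma sum_amps k : \sum_(x <- amps k) x <= 3 * k%:R * sd.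
Proof.
elim: k => [|k IHk]; first by rewrite big_nil mulr0 mul0r.
rewrite big_cat/= big_rcons/= big_nseq iter_addr_0.
have := small_amp_mul (stage_dim k); rewrite /big_amp -/(stage_dim k).
set c := small_amp _ => c_le; have c_gt0 : 0 < c by exact: small_amp_gt0.
have : c *+ (stage_dim k + 13) <= 13 * ((stage_dim k)%:R + 1) * c.
  rewrite -[leLHS]mulr_natl natrD ler_pM2r//.
  have := ler0n R (stage_dim k); lra.
have := sd_gt0; rewrite -natr1; lra.
Qed.
End Amplitudes.

(** * Numerical constraints and the final argument *)

Lemma wave_sum_itv (R : realType) (p n B : nat) (xi : nat -> 'rV['F_p]_n -> 'rV['F_p]_n)
    (a : nat -> R) x : (forall j, (j < B)%N -> 0 <= a j) ->
  \sum_(j < B) a j <= 1 / 2 -> 0 <= wave_sum B xi a x <= 1.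
Proof.
move=> a_ge0 sum_a; suff : `|\sum_(j < B) a j * wave R xi j x| <= 1 / 2.
  by rewrite ler_norml /wave_sum; lra.
apply: le_trans sum_a; apply: le_trans (ler_norm_sum _ _ _) _.
apply: ler_sum => j _; rewrite normrM ger0_norm ?a_ge0//.
by rewrite ler_piMr ?a_ge0// psi_abs_le1.
Qed.

(** For s = 0 use delta <= 1/40. Otherwise s sqrt delta <= 1/20, and s + 1 <= 2 s. *)
Lemma amplitude_budget (R : realType) (p : nat) (delta : R) : prime p ->
  0 < delta -> delta <= 1 / (20 * p%:R) ->
  3 * (Num.truncn ((Num.sqrt delta)^-1 / (10 * p%:R))).+1%:R * Num.sqrt delta
    <= 1 / 2.
Proof.
move=> p_pr delta_gt0 delta_le; set sd := Num.sqrt delta; set s := Num.truncn _.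
have sd_gt0 : 0 < sd by rewrite sqrtr_gt0.
have p2 : 2 <= p%:R :> R by rewrite ler_nat prime_gt1.
have [s0|s_gt0] := posnP s.
  have sd2 : sd * sd <= 1 / 40.
    rewrite -expr2 sqr_sqrtr; last exact: ltW.
    by apply: le_trans delta_le _; rewrite ler_pdivrMr; lra.
  by rewrite s0; nra.
have s_le : s%:R * sd <= 1 / 20.
  have : s%:R <= sd^-1 / (10 * p%:R).
    by rewrite truncn_le// divr_ge0 ?invr_ge0 ?ltW//; lra.
  rewrite ler_pdivlMr; last by lra.
  move=> /(ler_wpM2r (ltW sd_gt0)); rewrite mulVf ?gt_eqF// => sE.
  have : 0 <= s%:R * sd by rewrite mulr_ge0 ?ler0n// ltW.
  by nra.
have s1 : 1 <= s%:R :> R by rewrite ler1n.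
have : sd <= s%:R * sd by rewrite ler_peMl// ltW.
by rewrite -natr1; lra.
Qed.

Lemma small_amp_eps (R : realType) (p e d : nat) (delta : R) (eps : R) :
  prime p -> 0 < delta -> (e <= d)%N -> 0 < eps ->
  eps <= Num.sqrt delta / (80 * p%:R ^+ 2 * (d%:R + 1)) ->
  22 * eps < 3 * small_amp p delta e.
Proof.
move=> p_pr delta_gt0 ed eps_gt0 eps_le.
have : 15 / 2 * eps <= small_amp p delta d.
  apply: le_trans (ler_wpM2l _ eps_le) _; first by lra.
  rewrite /small_amp.
  have p0 : p%:R != 0 :> R by rewrite pnatr_eq0 -lt0n prime_gt0.
  have d1 : d%:R + 1 != 0 :> R by rewrite gt_eqF// ltr_wpDl.
  rewrite le_eqVlt; apply/orP; left; apply/eqP; field; by rewrite p0 d1.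
by have := small_amp_le p_pr delta_gt0 ed; lra.
Qed.

Theorem theoremA (R : realType) (p : nat) (p_pr : prime p)
    (delta : R) (delta_gt0 : 0 < delta) (delta_le : delta <= 1 / (20 * p%:R))
    (eps : nat -> R) (eps01 : forall d : nat, 0 < eps d < 1)
    (eps_noninc : forall d d' : nat, (d <= d')%N -> eps d' <= eps d)
    (eps_le : forall d : nat,
       eps d <= Num.sqrt delta / (80 * p%:R ^+ 2 * (d%:R + 1))) :
  let s : nat := Num.truncn ((Num.sqrt delta)^-1 / (10 * p%:R)) in
  (exists N : nat, forall n : nat, (N <= n)%N ->
     exists f : 'rV['F_p]_n -> R,
       (forall x, 0 <= f x <= 1) /\
       forall W1 W2 : {vspace 'rV['F_p]_n},
         (W2 <= W1)%VS ->
         regular (eps (codim W1)) f W2 ->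
         energy_vs f W2 - energy_vs f W1 <= delta ->
         (wwz s < codim W2)%N /\ (wwz s < codim W1)%N)
  /\
  (forall C : R,
     (forall (n : nat) (f : 'rV['F_p]_n -> R),
        (forall x, 0 <= f x <= 1) ->
        exists W1 W2 : {vspace 'rV['F_p]_n},
          [/\ (W2 <= W1)%VS,
              (codim W1)%:R <= C,
              regular (eps (codim W1)) f W2
            & energy_vs f W2 - energy_vs f W1 <= delta]) ->
     (wwz s)%:R < C).
Proof.
move=> s; set part1 := (exists N, _); suff main : part1.
  split=> // C hC; have [N /(_ N (leqnn N))[f [f01 f_prop]]] := main.
  have [W1 [W2 [sW W1C Wreg Wen]]] := hC N f f01.
  have [_ lt_W1] := f_prop W1 W2 sW Wreg Wen.
  by rewrite (lt_le_trans _ W1C)// ltr_nat.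
pose A := amps p delta; pose B := size (A s.+1).
exists (dims p B) => n le_n.
pose a j := nth 0 (A s.+1) j; pose xi := @frequency p p_pr n.
have sys := frequency_systemP p_pr R le_n.
have a_ge0 j : (j < B)%N -> 0 <= a j.
  move=> jB; apply: le_trans (amps_ge p_pr delta_gt0 (mem_nth 0 jB)).
  exact/ltW/small_amp_gt0.
have f01 x : 0 <= wave_sum B xi a x <= 1.
  apply: wave_sum_itv => //; have -> : \sum_(j < B) a j = \sum_(y <- A s.+1) y.
    by rewrite (big_nth 0) big_mkord.
  exact: le_trans (sum_amps p_pr delta_gt0 _) (amplitude_budget _ _ _).
exists (wave_sum B xi a); split=> // W1 W2 sW Wreg Wen.
suff W1_gt : (wwz s < codim W1)%N.
  by split=> //; rewrite (leq_trans W1_gt)// leq_sub2l// dimvS.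
apply: leq_ltn_trans (wwz_stage_dim delta p_pr s) _.
rewrite ltnNge; apply/negP => W1_le.
have ex_k : exists k, (codim W1 <= stage_dim p delta k.+1)%N by exists s.
(* By minimality stage [k] is the one with e_k <= codim W1 <= e_(k+1). *)
have [k W1_k k_min] := ex_minnP ex_k.
have ks : (k <= s)%N by exact: k_min.
have k_W1 : (stage_dim p delta k <= codim W1)%N.
  case: k W1_k k_min {ks} => // k _ /(_ k); rewrite ltnn.
  by case: leqP => [_ /(_ isT)|/ltnW].
have [eps_gt0 _] := andP (eps01 (codim W1)).
have size_le : (size (A k.+1) <= B)%N by exact: size_amps_le.
(* Level by level: every amplitude up to the end of stage [k] is at least [small_amp] at e_k, too
   large for a regular [W2] outside the next [flag]. *)
have W2_flag j : (j <= size (A k.+1))%N -> forall h, h \in W2 -> flag (dims p j) h.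
  elim: j => [_ h _|j IHj jk h hW]; first exact/flagP.
  have jB := leq_trans jk size_le.
  apply/idPn => h_out.
  have a_le := uniform_amplitude p_pr sys jB f01 (ltW eps_gt0) Wreg (IHj (ltnW jk))
    hW h_out.
  have a_ge : small_amp p delta (stage_dim p delta k) <= a j.
    by rewrite /a (nth_amps _ jk)//; apply: amps_ge => //; exact: mem_nth.
  have := small_amp_eps p_pr delta_gt0 k_W1 eps_gt0 (eps_le _).
  by move: a_le a_ge; move: (a j) (small_amp _ _ _) (eps _) => y c e; lra.
pose J := (size (A k.+1)).-1.
have JE : J.+1 = size (A k.+1) by rewrite /J /A size_ampsS.
have JB : (J < B)%N by rewrite JE.
have W1_J : (codim W1 <= dims p J)%N by [].
have J13 : (13 <= dims p J)%N by exact: (stage_dim_ge13 delta p_pr k).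
have Jn : (dims p J + width p (dims p J) <= n)%N.
  by apply: leq_trans le_n; rewrite -[leqLHS]/(dims p J.+1) dims_le.
(* The block of level [J] is longer than codim W1, so [W1] contains a vector that [W2] cannot. *)
have [v v0 vW1] := vspace_meets_block p_pr Jn (leq_ltn_trans W1_J (width_gt p_pr J13)).
pose u := embed n (dims p J) v.
have u_in : flag (dims p J) u.
  apply/flagP => l lJ; have [ln|/coord_out->//] := ltnP l n.
  by rewrite coord_embed// leqNgt lJ.
have u_out : ~~ flag (dims p J.+1) u.
  apply/flagP => u0; case/eqP: v0; rewrite -(embedK Jn v); apply/rowP => l.
  by rewrite !mxE u0//= ltn_add2l.
have := energy_amplitude p_pr sys a JB sW (W2_flag _ (eq_leq JE)) vW1 u_in u_out.
move=> /le_trans/(_ Wen).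
have -> : a J = big_amp delta 
  by rewrite /a (@nth_amps _ _ _ k.+1) ?JE//; exact: last_amps.
by rewrite /big_amp exprMn sqr_sqrtr ?(ltW delta_gt0)//; lra.
Qed.
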